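(* Let $\lambda_0,\lambda_1,\lambda_2>0$ and $\lambda=\lambda_0+\lambda_1+\lambda_2$. Let $N_0,N_1,N_2$ be mutually independent homogeneous Poisson processes with parameters $\lambda_0,\lambda_1,\lambda_2$ respectively, started at $0$, and put $$M_1(t)=N_1(t)+N_0(t),\qquad M_2(t)=N_2(t)+N_0(t),\qquad t\ge 0.$$ Let $N$ be a homogeneous Poisson process with parameter $\lambda$ and $N(0)=0$, let $(I_{1i},I_{2i},I_{0i})$, $i=1,2,\dots$, be i.i.d. random vectors, independent of $N$, with $$\mathbb{P}((I_{1i},I_{2i},I_{0i})=(1,0,0))=\frac{\lambda_1}{\lambda},\quad \mathbb{P}((I_{1i},I_{2i},I_{0i})=(0,1,0))=\frac{\lambda_2}{\lambda},\quad \mathbb{P}((I_{1i},I_{2i},I_{0i})=(0,0,1))=\frac{\lambda_0}{\lambda},$$ let $I_{10}=I_{20}=I_{00}=0$, and put $$A_1(t)=\sum_{i=0}^{N(t)}(I_{1i}+I_{0i}),\qquad A_2(t)=\sum_{i=0}^{N(t)}(I_{2i}+I_{0i}),\qquad t\ge 0.$$ Then the bivariate processes $\{(M_1(t),M_2(t)):t\ge0\}$ and $\{(A_1(t),A_2(t)):t\ge0\}$ have the same finite dimensional distributions.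
   Context: A homogeneous Poisson process with parameter $\lambda>0$ started at $0$ is a process with $N(0)=0$, independent stationary increments, and $N(t)$ Poisson distributed with mean $\lambda t$. All sums start from index $0$, whose term is $0$ by convention. *)

(* Defs.v *)
(* MathComp-Analysis *)
From HB Require Import structures.
From mathcomp Require Import all_boot all_order all_algebra finmap.
From mathcomp Require Import all_classical all_reals all_analysis.

Set Implicit Arguments.
Unset Strict Implicit.
Unset Printing Implicit Defensive.

Import Order.TTheory GRing.Theory Num.Theory.

Local Open Scope classical_set_scope.
Local Open Scope ring_scope.

Section independence.
Context d (T : measurableType d) (R : realType) (P : probability T R).

Definition mutual_independence (I : choiceType) (D : set I)
    (F : I -> set_system T) : Prop :=
  (forall i, D i -> F i `<=` measurable) /\
  forall J : {fset I}, [set` J] `<=` D ->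
  forall E : I -> set T, (forall i, i \in J -> F i (E i)) ->
    P (\bigcap_(i in [set` J]) E i) = (\prod_(i <- J) P (E i))%E.

End independence.

Definition sigma_family d (T : measurableType d) d' (S : measurableType d')
    (I : Type) (D : set I) (X : I -> T -> S) : set_system T :=
  <<s \bigcup_(i in D) preimage_set_system setT (X i) measurable >>.

(* Real-valued, because subtraction on nat is truncated. *)
Definition increment (R : realType) (T : Type) (N : R -> T -> nat) (s t : R)
    (w : T) : R := (N t w)%:R - (N s w)%:R.

(* A process is a family indexed by all of R, of which only the restriction to
   nonnegative times is ever used.  The second argument of poisson_prob does
   not occur in its value; poisson_prob 0 is the Dirac mass at 0. *)
Record poisson_process d (T : measurableType d) (R : realType)
    (P : probability T R) (lam : R) (N : R -> {RV P >-> nat}) : Prop := {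
  poisson_process0 : forall w, N 0 w = 0%N ;
  poisson_process_indep : forall t : nat -> R, 0 <= t 0%N -> increasing_seq t ->
    mutual_independence P [set: nat] (fun i =>
      g_sigma_algebra_preimage (increment N (t i) (t i.+1))) ;
  poisson_process_stationary : forall s t h : R, 0 <= s -> s <= t -> 0 <= h ->
    forall B : set R, measurable B ->
      P (increment N (s + h) (t + h) @^-1` B) = P (increment N s t @^-1` B) ;
  poisson_process_law : forall t : R, 0 <= t -> forall B : set nat,
    distribution P (N t) B = poisson_prob (lam * t) 0%N B }.

Arguments poisson_process {d T R} P lam N.

Section random_variables.
Context d (T : measurableType d).

Lemma measurable_random_index d' (S : measurableType d') (N : {mfun T >-> nat})
    (F : nat -> {mfun T >-> S}) : measurable_fun setT (fun w => F (N w) w).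
Proof.
move=> _ B mB; rewrite setTI.
rewrite (_ : _ @^-1` _ = \bigcup_k (N @^-1` [set k] `&` F k @^-1` B)); last first.
  by apply/seteqP; split=> [w /= FB|w [k _ [/= <-]]] //; exists (N w).
by apply: bigcup_measurable => k _; apply: measurableI;
  exact: measurable_funPTI.
Qed.

Lemma measurable_addn (X Y : {mfun T >-> nat}) :
  measurable_fun setT (fun w => X w + Y w)%N.
Proof.
have mF k : measurable_fun setT (fun w => k + Y w)%N.
  by apply: (@measurableT_comp _ _ _ _ _ _ (addn k)).
pose F k : {mfun T >-> nat} := HB.pack (fun w => k + Y w)%N
  (isMeasurableFun.Build _ _ _ _ _ (mF k)).
exact: (measurable_random_index X F).
Qed.

Definition addRV (X Y : {mfun T >-> nat}) (w : T) : nat := (X w + Y w)%N.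

HB.instance Definition _ X Y := isMeasurableFun.Build _ _ _ _ (addRV X Y)
  (measurable_addn X Y).

Definition partial_sum (X : nat -> {mfun T >-> nat}) (n : nat) (w : T) : nat :=
  (\sum_(0 <= i < n.+1) X i w)%N.

Lemma measurable_partial_sum X n : measurable_fun setT (partial_sum X n).
Proof.
elim: n => [|n IH].
  by rewrite /partial_sum; under eq_fun do rewrite big_nat1; exact: measurable_funPT.
pose F : {mfun T >-> nat} := HB.pack (partial_sum X n)
  (isMeasurableFun.Build _ _ _ _ _ IH).
rewrite (_ : partial_sum _ _ = addRV F (X n.+1)); first exact: measurable_funPT.
by apply/funext => w; rewrite /partial_sum big_nat_recr.
Qed.

HB.instance Definition _ X n := isMeasurableFun.Build _ _ _ _ (partial_sum X n)
  (measurable_partial_sum X n).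

Definition random_sum (N : {mfun T >-> nat}) (X : nat -> {mfun T >-> nat})
    (w : T) : nat := (\sum_(0 <= i < (N w).+1) X i w)%N.

HB.instance Definition _ N X := isMeasurableFun.Build _ _ _ _ (random_sum N X)
  (measurable_random_index N (partial_sum X)).

Definition pairRV d1 d2 (S1 : measurableType d1) (S2 : measurableType d2)
    (X : {mfun T >-> S1}) (Y : {mfun T >-> S2}) (w : T) : S1 * S2 := (X w, Y w).

HB.instance Definition _ d1 d2 S1 S2 X Y :=
  isMeasurableFun.Build _ _ _ _ (@pairRV d1 d2 S1 S2 X Y)
  (measurable_fun_pair (@measurable_funPT _ _ _ _ X)
                       (@measurable_funPT _ _ _ _ Y)).

Definition tupleRV d' (S : measurableType d') n (X : 'I_n -> {mfun T >-> S})
    (w : T) : n.-tuple S := [tuple X i w | i < n].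

Lemma measurable_tupleRV d' S n X : measurable_fun setT (@tupleRV d' S n X).
Proof.
apply/measurable_fun_tnthP => i.
rewrite (_ : _ \o _ = X i); first exact: measurable_funPT.
by apply/funext => w; rewrite /= tnth_mktuple.
Qed.

HB.instance Definition _ d' S n X := isMeasurableFun.Build _ _ _ _
  (@tupleRV d' S n X) (measurable_tupleRV X).

End random_variables.

(* The two processes may live on different probability spaces. *)
Definition same_fdd (R : realType) d' (S : measurableType d')
    d1 (T1 : measurableType d1) (P1 : probability T1 R)
    d2 (T2 : measurableType d2) (P2 : probability T2 R)
    (X : R -> {RV P1 >-> S}) (Y : R -> {RV P2 >-> S}) : Prop :=
  forall (n : nat) (t : 'I_n -> R), (forall i, 0 <= t i) ->
  forall B : set (n.-tuple S), measurable B ->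
    distribution P1 (tupleRV (fun i => X (t i))) B =
    distribution P2 (tupleRV (fun i => Y (t i))) B.

Definition iid_from1 d (T : measurableType d) (R : realType)
    (P : probability T R) d' (S : measurableType d')
    (X : nat -> {RV P >-> S}) : Prop :=
  mutual_independence P [set i | (1 <= i)%N]
    (fun i => g_sigma_algebra_preimage (X i)) /\
  forall i j, (1 <= i)%N -> (1 <= j)%N ->
  forall B : set S, measurable B -> distribution P (X i) B = distribution P (X j) B.

Arguments same_fdd {R d' S d1 T1} P1 {d2 T2} P2 X Y.
Arguments iid_from1 {d T R} P {d' S} X.

(* Main.v *)
Require Import Defs.
From HB Require Import structures.
From mathcomp Require Import all_boot all_order all_algebra finmap.
From mathcomp Require Import all_classical all_reals all_analysis.
From mathcomp Require Import zify ring.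

Import Order.TTheory GRing.Theory Num.Theory.

Local Open Scope classical_set_scope.
Local Open Scope ring_scope.

(** The marked Poisson process is split by colour.  Call the three possible
    values of a mark colours; colour j has probability p_j = lam_j / lam.  The
    claim follows from a statement on J-valued colours, J any finite type: if
    S_j(t) counts the marks of colour j among the first N(t), then (S_j)_j has
    the finite dimensional distributions of independent Poisson processes
    (N_j)_j of rates lam_j (colored_fdd).  Indeed M_1 = N_1 + N_0 and
    A_1 = S_1 + S_0 are the same function of these families, and so are M_2 and
    A_2.

    Both families take values in a countable set, so it is enough to compare the
    probabilities of single paths a_0, ..., a_m along a grid
    0 = s_0 < ... < s_m that contains all the times considered.  On the side of
    the N_j, independence of increments gives a product of Poisson weights of
    mean lam_j (s_(k+1) - s_k) over j and k (poisson_path_pmf).  On the other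
    side, if a starts at 0 and is nondecreasing and each of the first b_m marks
    has a colour, where b_k := sum_j a_k j, then the path is a if and only if
    N(s_k) = b_k for all k and the block of marks with indices
    b_k < i <= b_(k+1) contains a_(k+1) j - a_k j marks of colour j.  This gives a Poisson weight of mean lam (s_(k+1) - s_k) times a multinomial
    weight for each k, and the two products agree factor by factor
    (poisson_multinomial_pmf).

    Two devices shorten the argument.  Total masses are both 1, so an inequality
    between the weights of all single paths already forces equality of laws
    (countable_law_eq).  Hence a lower bound on the second side is enough, and it
    may leave out the null event that some mark has no colour.  The lower bound
    itself is propagated one mark at a time by the predicate
    free_after: the event E has probability at least x, even after it is
    intersected with any prescription of the colours of finitely many marks
    that follow the first b, at the cost of the product of the
    probabilities of these colours. *)

Set Implicit Arguments.
Unset Strict Implicit.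
Unset Printing Implicit Defensive.

(** * Independence and countable laws *)

Section measure_tools.
Context (R : realType).

(** A duplicate-free sequence is a more convenient index set than the finite set
    of the definition: [iota] and [index_enum] then give the factors in order. *)
Lemma mutual_independence_seq d (T : measurableType d) (P : probability T R)
    (I : choiceType) (D : set I) (F : I -> set_system T) (s : seq I)
    (E : I -> set T) :
  mutual_independence P D F -> uniq s -> [set` s] `<=` D ->
  (forall i, i \in s -> F i (E i)) ->
  P (\bigcap_(i in [set` s]) E i) = (\prod_(i <- s) P (E i))%E.
Proof.
move=> [_ indep] us sD FE; pose J := seq_fset tt s.
have JE : J =i s by move=> i; rewrite /J seq_fsetE.
have -> : [set` s] = [set` J] by apply/seteqP; split=> i /=; rewrite JE.
rewrite indep; last 2 first.
- by move=> i /=; rewrite JE => /sD.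
- by move=> i; rewrite JE => /FE.
apply: perm_big; rewrite uniq_perm ?fset_uniq//.
Qed.

(** By countable additivity the pointwise inequality passes to every set;
    applied to the complement of the set it gives the reverse inequality, because
    both masses are 1. *)
Lemma countable_law_eq d1 (T1 : measurableType d1) (P1 : probability T1 R)
    d2 (T2 : measurableType d2) (P2 : probability T2 R) (K : countType)
    (X : T1 -> K) (Y : T2 -> K) :
  (forall a, measurable (X @^-1` [set a])) ->
  (forall a, measurable (Y @^-1` [set a])) ->
  (forall a, P1 (X @^-1` [set a]) <= P2 (Y @^-1` [set a]))%E ->
  forall C : set K, P1 (X @^-1` C) = P2 (Y @^-1` C).
Proof.
move=> mX mY XY C.
(* The event that the value lies in B and has code n: it is either empty or the
   event that the value is one given point, whatever the random variable. *)
pose piece T (Z : T -> K) (B : set K) (n : nat) : set T :=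
  Z @^-1` (B `&` [set a : K | choice.pickle a = n]).
have pieceE T (Z : T -> K) B : Z @^-1` B = \bigcup_n piece T Z B n.
  by apply/seteqP; split=> [w Bw|w [n _ []]//]; exists (choice.pickle (Z w)).
have piece_triv T (Z : T -> K) B : trivIset setT (piece T Z B).
  by move=> m n _ _ [w [[_ <-] [_ <-]]].
have piece_pt B n : (forall T (Z : T -> K), piece T Z B n = set0) \/
    exists a, forall T (Z : T -> K), piece T Z B n = Z @^-1` [set a].
  have [[a [Ba an]]|no] := pselect (exists a, B a /\ choice.pickle a = n).
    right; exists a => T Z; apply/seteqP; split=> [w [_ /= wn]|w /= Za].
      by apply: (pcan_inj choice.pickleK); rewrite wn an.
    by rewrite /piece /= Za; split.
  by left=> T Z; apply/seteqP; split=> // w [Bw Zw]; apply: no; exists (Z w).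
have mpiece d (T : measurableType d) (Z : T -> K) B n :
    (forall a, measurable (Z @^-1` [set a])) -> measurable (piece T Z B n).
  by move=> mZ; have [->|[a ->]] := piece_pt B n; [exact: measurable0|].
have mpre d (T : measurableType d) (Z : T -> K) B :
    (forall a, measurable (Z @^-1` [set a])) -> measurable (Z @^-1` B).
  by move=> mZ; rewrite pieceE; apply: bigcup_measurable => n _; exact: mpiece.
have le B : (P1 (X @^-1` B) <= P2 (Y @^-1` B))%E.
  rewrite (pieceE _ X) (pieceE _ Y) !measure_semi_bigcup -?pieceE;
    [|by [exact: mpre|exact: piece_triv|move=> n; exact: mpiece]..].
  apply: lee_nneseries => [i _ _|n _]; first exact: measure_ge0.
  have [no|[a pt]] := piece_pt B n.
    by rewrite [leLHS](_ : _ = 0%E) ?measure_ge0// no measure0.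
  by have := XY a; rewrite -(pt _ X) -(pt _ Y).
apply/eqP; rewrite eq_le le/=.
have := le (~` C).
have pC : P1 (X @^-1` (~` C)) = (1 - P1 (X @^-1` C))%E.
  exact: probability_setC (mpre _ _ X C mX).
have qC : P2 (Y @^-1` (~` C)) = (1 - P2 (Y @^-1` C))%E.
  exact: probability_setC (mpre _ _ Y C mY).
rewrite pC qC.
have /fineK <- : P1 (X @^-1` C) \is a fin_num.
  exact: fin_num_measure (mpre _ _ X C mX).
have /fineK <- : P2 (Y @^-1` C) \is a fin_num.
  exact: fin_num_measure (mpre _ _ Y C mY).
by rewrite -!EFinB !lee_fin lerD2l lerN2.
Qed.

Lemma mutual_independence_pair d (T : measurableType d)
    (P : probability T R) (F G : set_system T) (A B : set T) :
  mutual_independence P [set: 'I_2] (tnth [tuple F; G]) -> F A -> G B ->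
  P (A `&` B) = (P A * P B)%E.
Proof.
move=> FG FA GB.
have := mutual_independence_seq (E := tnth [tuple A; B]) FG
  (index_enum_uniq 'I_2) (@subsetT _ _).
rewrite big_ord_recl big_ord1 => <-; last by case=> -[|[|]].
congr (P _); apply/seteqP; split=> w => [[Aw Bw] [[|[|]]//] i _//|ABw].
by split; [have := ABw ord0|have := ABw ord_max]; apply; rewrite /= mem_index_enum.
Qed.

Lemma sigma_family_bigcap d0 (T0 : measurableType d0) d1 (S1 : measurableType d1)
    (I : Type) (D : set I) (Y : I -> T0 -> S1) (K : choiceType) (s : seq K)
    (f : K -> I) (B : K -> set S1) :
  (forall k, k \in s -> D (f k)) -> (forall k, measurable (B k)) ->
  sigma_family D Y (\bigcap_(k in [set` s]) Y (f k) @^-1` B k).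
Proof.
move=> sD mB.
apply: (@fin_bigcap_measurable _ (g_sigma_algebraType
  (\bigcup_(i in D) preimage_set_system setT (Y i) measurable))) => // k /= /sD Dk.
by apply: sub_sigma_algebra; exists (f k) => //; exists (B k) => //; rewrite setTI.
Qed.

Lemma bigcap_upto (W : Type) (F : nat -> set W) m :
  \bigcap_(k in [set` index_iota 0 m.+1]) F k =
  [set w | forall k, (k <= m)%N -> F k w].
Proof. by apply/seteqP; split=> w Fw k; have := Fw k; rewrite /= mem_index_iota. Qed.

Lemma measurable_path d0 (T0 : measurableType d0) (J : finType)
    (Y : nat -> J -> {mfun T0 >-> nat})
    (a : nat -> J -> nat) m :
  measurable [set w | forall k, (k <= m)%N -> forall j, Y k j w = a k j].
Proof.
rewrite (_ : [set w | _] = \bigcap_(k in [set k | (k <= m)%N])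
    \bigcap_(j in [set: J]) Y k j @^-1` [set a k j]).
  apply: bigcap_measurableType => k _; apply: fin_bigcap_measurable => // j _.
  exact: measurable_funPTI.
by apply/seteqP; split=> [w aw k km j _|w aw k km j]; exact: aw.
Qed.

End measure_tools.

(** * Paths of a Poisson process *)

Section poisson_paths.
Context (R : realType) d (T : measurableType d) (P : probability T R).
Variables (lam : R) (N : R -> {RV P >-> nat}).
Hypotheses (lam_gt0 : 0 < lam) (NP : poisson_process P lam N).

(** By stationarity the increment has the law of N (t - s).  The value is written
    as a difference of two path values, which may be negative: then its
    probability is 0. *)
Lemma poisson_increment_pmf (s t : R) (a b : nat) : 0 <= s -> s < t ->
  P (increment N s t @^-1` [set b%:R - a%:R]) =
  (if (a <= b)%N then poisson_pmf (lam * (t - s)) (b - a) else 0)%:E.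
Proof.
move=> s0 st; have ts0 : 0 < t - s by rewrite subr_gt0.
have := poisson_process_stationary NP (lexx 0) (ltW ts0) s0.
move=> /(_ [set b%:R - a%:R]); rewrite add0r subrK => -> //.
have incE w : increment N 0 (t - s) w = (N (t - s) w)%:R.
  by rewrite /increment (poisson_process0 NP) subr0.
case: leqP => ab.
- have -> : increment N 0 (t - s) @^-1` [set b%:R - a%:R] =
      N (t - s) @^-1` [set (b - a)%N].
    apply/seteqP; split=> w /=; rewrite incE -natrB//; last by move=> ->.
    by move=> /eqP; rewrite eqr_nat => /eqP.
  have := poisson_process_law NP (ltW ts0) [set (b - a)%N].
  rewrite /distribution /pushforward => ->.
  rewrite /poisson_prob mulr_gt0// esum_set1// lee_fin poisson_pmf_ge0//.
- rewrite (_ : _ @^-1` _ = set0) ?measure0//.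
  apply/seteqP; split=> // w /=; rewrite incE => /eqP.
  by rewrite -subr_eq0 opprB addrA -natrD subr_eq0 eqr_nat => /eqP; lia.
Qed.

(** A path along the grid s is determined by its increments, which are
    independent. *)
Lemma poisson_path_pmf (s : nat -> R) (a : nat -> nat) m :
  s 0%N = 0 -> increasing_seq s -> a 0%N = 0%N ->
  P [set w | forall k, (k <= m)%N -> N (s k) w = a k] =
  (\prod_(0 <= k < m) if (a k <= a k.+1)%N
     then poisson_pmf (lam * (s k.+1 - s k)) (a k.+1 - a k) else 0)%:E.
Proof.
move=> s0 smono a0.
have slt k : s k < s k.+1 by rewrite ltNge smono -ltnNge.
have s_ge0 k : 0 <= s k by rewrite -s0 smono.
have indep := poisson_process_indep NP (s_ge0 0%N) smono.
pose E k := increment N (s k) (s k.+1) @^-1` [set (a k.+1)%:R - (a k)%:R].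
have -> : [set w | forall k, (k <= m)%N -> N (s k) w = a k] =
    \bigcap_(k in [set` index_iota 0 m]) E k.
  apply/seteqP; split=> w /= path_w.
    move=> k /=; rewrite mem_index_iota => km.
    by rewrite /E /= /increment !path_w// ltnW.
  elim=> [_|k IH km]; first by rewrite s0 a0 (poisson_process0 NP).
  have := path_w k; rewrite /= mem_index_iota => /(_ km).
  rewrite /E /= /increment IH ?(ltnW km)// => /addIr/eqP.
  by rewrite eqr_nat => /eqP.
rewrite (mutual_independence_seq indep) ?iota_uniq//; last first.
  by move=> k _; exists [set (a k.+1)%:R - (a k)%:R] => //; rewrite setTI.
by rewrite -prodEFin; apply: eq_bigr => k _; rewrite poisson_increment_pmf.
Qed.

End poisson_paths.

(** * Multinomial weights *)

Section multinomial.
Context (R : realType) (J : finType).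
Implicit Types (p : J -> R) (c : J -> nat).

Definition multinomial_pmf p c : R :=
  (\sum_j c j)`!%:R * \prod_j (p j ^+ c j / (c j)`!%:R).

Lemma sum_decr c (j : J) : (0 < c j)%N ->
  (\sum_i c i = (\sum_i (c i - (i == j))).+1)%N.
Proof.
move=> cj; rewrite (bigD1 j)//= [in RHS](bigD1 j)//= eqxx -addSn subn1 prednK//.
by congr addn; apply: eq_bigr => i /negPf ->; rewrite subn0.
Qed.

(** Condition on the colour j of the last draw.  Algebraically, the j-th summand
    is c_j / n times the left-hand side, where n is the sum of the c_j. *)
Lemma multinomial_pmf_rec p c : (0 < \sum_j c j)%N ->
  multinomial_pmf p c =
  \sum_(j | (0 < c j)%N) multinomial_pmf p (fun i => c i - (i == j))%N * p j.
Proof.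
case E : (\sum_j c j)%N => [//|n] _.
pose w := \prod_j (p j ^+ c j / (c j)`!%:R).
have -> : multinomial_pmf p c = \sum_j (n`!%:R * w * (c j)%:R).
  by rewrite /multinomial_pmf E -mulr_sumr -natr_sum E factS natrM -/w; ring.
rewrite (bigID (fun j => 0 < c j)%N)/= [X in _ + X]big1 ?addr0; last first.
  by move=> j; rewrite -eqn0Ngt => /eqP ->; rewrite mulr0.
apply: eq_bigr => j cj; rewrite /multinomial_pmf.
have /eqP := sum_decr cj; rewrite E eqSS => /eqP <-.
rewrite -!mulrA; congr (_ * _); rewrite /w (bigD1 j)//= [in RHS](bigD1 j)//= eqxx.
rewrite subn1 mulrAC [RHS]mulrAC; congr (_ * _); last first.
  by apply: eq_bigr => i /negPf ->; rewrite subn0.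
case: (c j) cj => // k _ /=; rewrite factS natrM exprSr.
by field; rewrite -(natrD _ 1) !pnatr_eq0 -lt0n fact_gt0.
Qed.

(** Splitting of a Poisson variable: the total count n of a time interval of
    length h enters the two weights on the left as n! and 1 / n!, which cancel, as
    do the powers of the total rate. *)
Lemma poisson_multinomial_pmf (lam : J -> R) (h : R) c :
  (forall j, 0 < lam j) -> 0 < h -> 0 < \sum_j lam j ->
  poisson_pmf ((\sum_j lam j) * h) (\sum_j c j)
    * multinomial_pmf (fun j => lam j / \sum_j lam j) c =
  \prod_j poisson_pmf (lam j * h) (c j).
Proof.
move=> lam0 h0 L0; set L := \sum_j lam j in L0 *.
rewrite /poisson_pmf /multinomial_pmf mulr_gt0//.
under [RHS]eq_bigr do rewrite mulr_gt0//.
rewrite !big_split/= -expR_sum sumrN -mulr_suml -/L.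
set n := (\sum_j c j)%N.
have -> : \prod_j (lam j / L) ^+ c j = (\prod_j lam j ^+ c j) * L ^- n.
  under eq_bigr do rewrite exprMn exprVn.
  by rewrite big_split/= prodfV prodrXr.
have -> : \prod_j (lam j * h) ^+ c j = (\prod_j lam j ^+ c j) * h ^+ n.
  by under eq_bigr do rewrite exprMn; rewrite big_split/= prodrXr.
rewrite exprMn; field.
by rewrite expf_neq0 ?gt_eqF// pnatr_eq0 -lt0n fact_gt0.
Qed.

End multinomial.

(** * Lower bounds that propagate along the marks *)

(** A i j is the event that mark i has colour j and X l i is the number that
    mark i adds to the count of colour l: 0 or 1 once mark i has a colour.  Marks
    are numbered from 1. *)
Section marks.
Context (R : realType) d (T : measurableType d) (Q : probability T R).
Context (J : finType).
Variables (p : J -> R) (A : nat -> J -> set T) (X : J -> nat -> {RV Q >-> nat}).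
Hypotheses (mA : forall i j, measurable (A i j)).
Hypotheses (X0 : forall j w, X j 0%N w = 0%N).
Hypotheses (XA : forall i j l w, (0 < i)%N -> A i j w -> X l i w = (l == j)).

Definition marked_after (b n : nat) (f : nat -> J) : set T :=
  \bigcap_(i in [set` iota b.+1 n]) A i (f i).

(** The lower bound x on the probability of E, in a form that survives the
    observation of further marks.  It is preserved by prescribing the next colour
    ([free_after_mark]) and by disjoint unions ([free_after_union]), which is all
    that counting colours requires. *)
Definition free_after (b : nat) (E : set T) (x : R) : Prop :=
  measurable E /\ forall n f,
    ((x * \prod_(i <- iota b.+1 n) p (f i))%:E
       <= Q (E `&` marked_after b n f))%E.

Lemma free_after_le b E x (j : J) : free_after b E x -> (x%:E <= Q E)%E.
Proof.
move=> [_ /(_ 0%N (fun=> j))]; rewrite big_nil mulr1 => /le_trans; apply.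
by rewrite /marked_after set_nil bigcap_set0 setIT.
Qed.

Lemma measurable_marked_after b n f : measurable (marked_after b n f).
Proof. by apply: bigcap_measurableType => i _; exact: mA. Qed.

(** Prescribing the colour of mark b + 1 and then those of the following n marks
    amounts to one prescription for the n + 1 marks after b. *)
Lemma free_after_mark b E x j :
  free_after b E x -> free_after b.+1 (E `&` A b.+1 j) (x * p j).
Proof.
move=> [mE bound]; split=> [|n f]; first exact: measurableI.
pose g i := if i == b.+1 then j else f i.
have gb : g b.+1 = j by rewrite /g eqxx.
have gf i : i \in iota b.+2 n -> g i = f i.
  by rewrite mem_iota /g => ib; rewrite ifN//; lia.
have -> : E `&` A b.+1 j `&` marked_after b.+1 n f = E `&` marked_after b n.+1 g.
  rewrite -setIA; congr (_ `&` _).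
  have iotaE : [set` iota b.+1 n.+1] = b.+1 |` [set` iota b.+2 n].
    apply/seteqP; split=> i /=; rewrite inE; first by case/predU1P; [left|right].
    by move=> ?; apply/predU1P.
  rewrite /marked_after iotaE bigcap_setU1 gb; congr (_ `&` _).
  by apply: eq_bigcapr => i /= /gf <-.
apply: le_trans (bound n.+1 g).
rewrite /= big_cons gb mulrA lee_fin.
by rewrite [X in _ * X <= _](eq_big_seq (fun i => p (g i))) // => i /gf ->.
Qed.

(** E only has to contain the disjoint pieces, so marks without a colour may be
    ignored when an event is decomposed by the colour of a mark. *)
Lemma free_after_union b (E : set T) (S : {pred J}) (F : J -> set T) (x : J -> R) :
  measurable E -> (forall j, S j -> F j `<=` E) ->
  (forall j, S j -> free_after b (F j) (x j)) -> trivIset setT F ->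
  free_after b E (\sum_(j | S j) x j).
Proof.
move=> mE FE freeF trivF; split=> // n f; set W := marked_after b n f.
have mW : measurable W by exact: measurable_marked_after.
pose s := [seq j <- index_enum J | S j].
have sS j : j \in s -> S j by rewrite mem_filter => /andP[].
have mF j : [set` s] j -> measurable (F j) by move=> /sS/freeF[].
apply: (@le_trans _ _ (Q (\bigcup_(j in [set` s]) (F j `&` W)))); last first.
  apply: le_measure; rewrite ?inE.
  - by apply: fin_bigcup_measurable => // j sj; apply: measurableI => //; exact: mF.
  - exact: measurableI.
  - by move=> w [j /= /sS Sj [Fw Ww]]; split=> //; exact: FE Fw.
rewrite measure_fin_bigcup//; last 2 first.
- by apply: trivIset_setIr; apply: sub_trivIset trivF.
- by move=> j Sj; apply: measurableI => //; exact: mF.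
rewrite -fsbig_seq ?filter_uniq ?index_enum_uniq// /s big_filter.
rewrite mulr_suml -sumEFin; apply: lee_sum => j Sj.
by have [_] := freeF j Sj; apply.
Qed.

Definition counts_at b (c : J -> nat) : set T :=
  [set w | forall j, partial_sum (X j) b w = c j].

Lemma measurable_counts_at b c : measurable (counts_at b c).
Proof.
rewrite (_ : counts_at b c =
    \bigcap_(j in [set: J]) partial_sum (X j) b @^-1` [set c j]).
  by apply: fin_bigcap_measurable => // j _; exact: measurable_funPTI.
by apply/seteqP; split=> [w cw j _|w cw j]; exact: cw.
Qed.

(** Induction on the length of the block, decomposing by the colour j of its last
    mark: the other marks then have colour counts c minus one unit at j, and the
    bounds add up by the recursion of the multinomial weights. *)
Lemma free_after_block b E x a n c : free_after b E x -> E `<=` counts_at b a ->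
  (\sum_j c j)%N = n ->
  free_after (b + n) (E `&` counts_at (b + n) (fun j => a j + c j)%N)
    (x * multinomial_pmf p c).
Proof.
move=> freeE Ea; elim: n c => [|n IH] c cn.
  have c0 j : c j = 0%N.
    by move/eqP: cn; rewrite (bigD1 j)//= addn_eq0 => /andP[/eqP].
  rewrite addn0 (_ : multinomial_pmf p c = 1) ?mulr1; last first.
    rewrite /multinomial_pmf cn fact0 mul1r big1// => j _.
    by rewrite c0 expr0 fact0 divr1.
  by rewrite setIidl// => w /Ea aw j; rewrite aw c0 addn0.
rewrite multinomial_pmf_rec ?cn// mulr_sumr addnS.
pose F j := E `&` counts_at (b + n) (fun i => a i + (c i - (i == j)))%N
  `&` A (b + n).+1 j.
apply: (@free_after_union _ _ _ F).
- by apply: measurableI; [case: freeE|exact: measurable_counts_at].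
- move=> j cj w [[Ew cw] Aw]; split=> // i.
  rewrite /partial_sum big_nat_recr//= [X in (X + _)%N](cw i) (XA _ (ltn0Sn _) Aw)//.
  by rewrite -addnA subnK//; case: eqP => // ->.
- move=> j cj; rewrite mulrA; apply: free_after_mark; apply: IH.
  by apply/eqP; rewrite -eqSS -sum_decr// cn.
- move=> j l _ _ [w [[_ Aj] [_ Al]]].
  by have := XA j (ltn0Sn _) Aj; rewrite eqxx (XA j (ltn0Sn _) Al); case: eqP.
Qed.

(** Successive blocks: at each k the counts after the first sum_j a_k j marks are
    prescribed to be a_k, which fixes the counts of the block between two
    successive values of k. *)
Lemma free_after_path E x (a : nat -> J -> nat) m : free_after 0 E x ->
  (forall j, a 0%N j = 0%N) -> (forall k j, (k < m)%N -> a k j <= a k.+1 j)%N ->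
  free_after (\sum_j a m j)
    (E `&` [set w | forall k, (k <= m)%N -> counts_at (\sum_j a k j) (a k) w])
    (x * \prod_(0 <= k < m) multinomial_pmf p (fun j => a k.+1 j - a k j)%N).
Proof.
move=> freeE a0; elim: m => [|m IH] amono.
  rewrite big_nil mulr1 big1 ?setIidl// => w Ew k; rewrite leqn0 => /eqP -> j.
  by rewrite big1// /partial_sum big_nat1 X0 a0.
have freeIH := IH (fun k j km => amono k j (ltnW km)).
have am1 : (\sum_j a m.+1 j = \sum_j a m j + \sum_j (a m.+1 j - a m j))%N.
  by rewrite -big_split/=; apply: eq_bigr => j _; rewrite subnKC// amono.
have Sm : E `&` [set w | forall k, (k <= m)%N -> counts_at (\sum_j a k j) (a k) w]
    `<=` counts_at (\sum_j a m j) (a m) by move=> w [_]; exact.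
have := free_after_block (c := fun j => a m.+1 j - a m j)%N freeIH Sm erefl.
rewrite -am1 big_nat_recr//= mulrA.
have -> : (fun j => a m j + (a m.+1 j - a m j))%N = a m.+1.
  by apply/funext => j; rewrite subnKC// amono.
set W := (X in free_after _ X _ -> _); set V := (X in _ -> free_after _ X _).
suff -> : W = V by [].
apply/seteqP; split=> w.
  move=> [[Ew pw] cw]; split=> // k; rewrite leq_eqVlt => /orP[/eqP->//|].
  exact: pw.
by move=> [Ew pw]; split; [split=> // k km; apply: pw; exact: leqW|exact: pw].
Qed.

End marks.

(** * Splitting a Poisson process by independent colours *)

(** The grid is infinite because independence of increments is stated for
    infinite sequences of times: the sorted times, preceded by 0, are continued by
    unit steps after the largest one. *)
Lemma time_grid (R : realType) n (t : 'I_n -> R) : (forall i, 0 <= t i) ->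
  exists m (s : nat -> R) (k : 'I_n -> 'I_m.+1),
    [/\ s 0%N = 0, increasing_seq s & forall i, t i = s (k i)].
Proof.
move=> t_ge0; pose l := sort <=%O (undup (0 :: codom t)).
have l_mem x : (x \in l) = (x \in 0 :: codom t) by rewrite mem_sort mem_undup.
have l_lt : sorted <%O l.
  by rewrite sort_lt_sorted undup_uniq.
have l_ge0 x : x \in l -> 0 <= x.
  by rewrite l_mem inE => /predU1P[->//|/codomP[i ->]].
have l0 : 0 \in l by rewrite l_mem mem_head.
case lE : (size l) => [|m]; first by move/size0nil: lE l0 => ->.
(* The truncated difference vanishes as long as k is an index of l. *)
pose s k := nth (last 0 l) l k + (k.+1 - size l)%:R.
have s_nth k : (k < size l)%N -> s k = nth (last 0 l) l k.
  by move=> kl; rewrite /s (eqP kl) addr0.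
have idx x : x \in l -> (index x l < m.+1)%N by rewrite -index_mem lE.
exists m, s, (fun i => inord (index (t i) l)); split.
- apply/eqP; rewrite eq_le s_nth ?lE//; apply/andP; split; last first.
    by rewrite l_ge0// mem_nth// lE.
  rewrite -{2}(nth_index (last 0 l) l0).
  rewrite (lt_sorted_leq_nth _ l_lt) ?inE ?lE ?idx//.
- apply/increasing_seqP => k; rewrite /s.
  have [kl|lk] := ltnP k.+1 (size l).
    rewrite (eqP kl) (eqP (ltnW kl)) !addr0.
    by rewrite (lt_sorted_ltn_nth _ l_lt) ?inE ?(ltnW kl).
  have -> : nth (last 0 l) l k = last 0 l.
    move: lk; rewrite leq_eqVlt => /predU1P[lk|lk]; last by rewrite nth_default.
    by rewrite (set_nth_default 0) ?lk// -nth_last lk.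
  by rewrite nth_default// ltrD2l ltr_nat; lia.
- move=> i; have til : t i \in l by rewrite l_mem inE codom_f orbT.
  by rewrite inordK ?idx// s_nth ?index_mem// nth_index.
Qed.

(** The mark V i has colour j when it lies in C j.  The rate of N is the sum of the
    rates lam j, and colour j has probability lam j over that sum. *)
Section thinning.
Context (R : realType) (J : finType) (lam : J -> R).
Context d (T : measurableType d) (P : probability T R).
Context d' (T' : measurableType d') (Q : probability T' R).
Context dS (S : measurableType dS).
Variables (N_ : J -> R -> {RV P >-> nat}) (N : R -> {RV Q >-> nat}).
Variables (V : nat -> {RV Q >-> S}) (C : J -> set S).
Variables (X : J -> nat -> {RV Q >-> nat}).

Local Notation L := (\sum_j lam j).
Local Notation pos := [set t : R | 0 <= t].
Local Notation ge1 := [set i | (1 <= i)%N].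

Hypotheses (lam_gt0 : forall j, 0 < lam j) (L_gt0 : 0 < L).
Hypotheses (N_poisson : forall j, poisson_process P (lam j) (N_ j)).
Hypotheses (N_indep : mutual_independence P [set: J]
  (fun j => sigma_family pos (N_ j))).
Hypotheses (NP : poisson_process Q L N).
Hypotheses (V_indep : mutual_independence Q ge1
  (fun i => g_sigma_algebra_preimage (V i))).
Hypotheses (NV_indep : forall E F, sigma_family pos N E -> sigma_family ge1 V F ->
  Q (E `&` F) = (Q E * Q F)%E).
Hypotheses (mC : forall j, measurable (C j)).
Hypotheses (VC : forall i j, (1 <= i)%N -> Q (V i @^-1` C j) = (lam j / L)%:E).
Hypotheses (X0 : forall j w, X j 0%N w = 0%N).
Hypotheses (XC : forall i j l w, (0 < i)%N -> C j (V i w) -> X l i w = (l == j)).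

Let p j := lam j / L.
Let A i j := V i @^-1` C j.

Let mA i j : measurable (A i j).
Proof. exact: measurable_funPTI. Qed.

(** Events that depend on N only are independent of all marks, and the marks are
    independent of each other. *)
Let free_after0 E x : sigma_family pos N E -> measurable E -> Q E = x%:E ->
  free_after Q p A 0 E x.
Proof.
move=> NE mE QE; split=> // n f.
have sge1 i : i \in iota 1 n -> (1 <= i)%N by rewrite mem_iota => /andP[].
rewrite NV_indep//; last by apply: sigma_family_bigcap.
rewrite QE /marked_after (mutual_independence_seq V_indep) ?iota_uniq//; last first.
  by move=> i _; exists (C (f i)) => //; rewrite setTI.
rewrite EFinM -prodEFin le_eqVlt; apply/orP; left; apply/eqP; congr (_ * _)%E.
by apply: eq_big_seq => i /sge1 i1; rewrite /A VC.
Qed.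

(** A path that does not start at 0 or decreases somewhere has probability 0 on
    the left.  Otherwise the right-hand event contains the one where N is equal to
    the total count b at each grid point and the first b k marks have colour
    counts a k. *)
Let colored_path_le (s : nat -> R) (a : nat -> J -> nat) m :
  s 0%N = 0 -> increasing_seq s ->
  (P [set w | forall k, (k <= m)%N -> forall j, N_ j (s k) w = a k j] <=
   Q [set w | forall k, (k <= m)%N -> forall j,
                random_sum (N (s k)) (X j) w = a k j])%E.
Proof.
move=> s0 smono.
have s_ge0 k : 0 <= s k by rewrite -s0 smono.
have s_lt k : s k < s k.+1 by rewrite ltNge smono -ltnNge.
have [a0|/existsNP[j a0]] := pselect (forall j, a 0%N j = 0%N); last first.
  rewrite (_ : [set w | _] = set0) ?measure0//; apply/seteqP; split=> // w.
  by move=> /(_ 0%N isT j); rewrite s0 (poisson_process0 (N_poisson j)) => /esym.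
have -> : [set w | forall k, (k <= m)%N -> forall j, N_ j (s k) w = a k j] =
    \bigcap_(j in [set` index_enum J])
      [set w | forall k, (k <= m)%N -> N_ j (s k) w = a k j].
  apply/seteqP; split=> [w aw j _ k km|w aw k km j]; first exact: aw.
  by apply: aw => //=; rewrite mem_index_enum.
rewrite (mutual_independence_seq N_indep) ?index_enum_uniq//; last first.
  move=> j _.
  rewrite -(bigcap_upto (fun k => N_ j (s k) @^-1` [set a k j])).
  apply: (@sigma_family_bigcap _ _ _ _ _ pos (fun t => N_ j t) _ _ s).
  - by move=> k _; exact: s_ge0.
  - by [].
under eq_bigr do rewrite (poisson_path_pmf (lam_gt0 _) (N_poisson _))//.
rewrite prodEFin exchange_big/=.
have [amono|/existsNP[k /existsNP[j /not_implyP[km /negP akj]]]] :=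
    pselect (forall k j, (k < m)%N -> (a k j <= a k.+1 j)%N); last first.
  rewrite (bigD1_seq k) ?mem_index_iota ?iota_uniq//= (bigD1 j)//= ifN//.
  by rewrite !mul0r measure_ge0.
pose b k := (\sum_j a k j)%N.
have bB k : (k < m)%N -> (b k.+1 - b k = \sum_j (a k.+1 j - a k j))%N.
  by move=> km; rewrite /b sumnB// => j _; exact: amono.
pose E := [set w | forall k, (k <= m)%N -> N (s k) w = b k].
pose x := \prod_(0 <= k < m) poisson_pmf (L * (s k.+1 - s k)) (b k.+1 - b k).
have QE : Q E = x%:E.
  rewrite /E (poisson_path_pmf L_gt0 NP)//; last by rewrite /b big1.
  congr (_%:E); rewrite /x !big_nat; apply: eq_bigr => k /andP[_ km].
  by rewrite leq_sum// => j _; exact: amono.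
have EE : E = \bigcap_(k in [set` index_iota 0 m.+1]) N (s k) @^-1` [set b k].
  by rewrite bigcap_upto.
have mE : measurable E.
  by rewrite EE; apply: fin_bigcap_measurable => // k _; exact: measurable_funPTI.
have NE : sigma_family pos N E.
  rewrite EE; apply: (@sigma_family_bigcap _ _ _ _ _ pos (fun t => N t) _ _ s).
  - by move=> k _; exact: s_ge0.
  - by [].
have [j0 _] : exists j0 : J, True.
  case: (pickP (fun _ : J => true)) => [j0 _|J0]; first by exists j0.
  by move: L_gt0; rewrite big_pred0// ltxx.
have := free_after_path mA X0 XC (free_after0 NE mE QE) a0 amono.
move=> /(free_after_le j0) bound.
apply: (le_trans _ (le_trans bound _)); last first.
  apply: le_measure; rewrite ?inE; last first.
  - by move=> w [Ew cw] k km j; rewrite /random_sum Ew//; exact: cw.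
  - exact: (measurable_path (fun k j => random_sum (N (s k)) (X j))).
  - apply: measurableI => //.
    exact: (measurable_path (fun k j => partial_sum (X j) (b k))).
rewrite lee_fin /x -big_split/= le_eqVlt; apply/orP; left; apply/eqP.
rewrite !big_nat; apply: eq_bigr => k /andP[_ km].
rewrite bB// poisson_multinomial_pmf ?subr_gt0//.
by apply: eq_bigr => j _; rewrite amono.
Qed.

(** The law of the counts at the times t is the image of the law along the grid,
    to which the comparison of single paths applies. *)
Lemma colored_fdd n (t : 'I_n -> R) (B : set {ffun 'I_n * J -> nat}) :
  (forall i, 0 <= t i) ->
  P ((fun w => [ffun ij : 'I_n * J => N_ ij.2 (t ij.1) w]) @^-1` B) =
  Q ((fun w => [ffun ij : 'I_n * J =>
                 random_sum (N (t ij.1)) (X ij.2) w]) @^-1` B).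
Proof.
move=> t_ge0; have [m [s [k [s0 smono sk]]]] := time_grid t_ge0.
pose grid U (Y : R -> J -> U -> nat) w : {ffun 'I_m.+1 * J -> nat} :=
  [ffun kj : 'I_m.+1 * J => Y (s kj.1) kj.2 w].
pose at_times (v : {ffun 'I_m.+1 * J -> nat}) : {ffun 'I_n * J -> nat} :=
  [ffun ij => v (k ij.1, ij.2)].
have gridE U (Y : R -> J -> U -> nat) w :
    [ffun ij : 'I_n * J => Y (t ij.1) ij.2 w] = at_times (grid U Y w).
  by apply/ffunP => -[i j]; rewrite !ffunE /= sk.
have pointE U (Y : R -> J -> U -> nat) v : grid U Y @^-1` [set v] =
    [set w | forall i, (i <= m)%N -> forall j, Y (s i) j w = v (inord i, j)].
  apply/seteqP; split=> w /= => [<- i im j|Yv].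
    by rewrite ffunE /= inordK.
  apply/ffunP => -[i j]; rewrite ffunE /= Yv ?inord_val//.
  by rewrite -ltnS.
have -> : (fun w => [ffun ij : 'I_n * J => N_ ij.2 (t ij.1) w]) @^-1` B =
    grid T (fun t j => N_ j t) @^-1` (at_times @^-1` B).
  by apply/seteqP; split=> w /=; rewrite (gridE _ (fun t j => N_ j t)).
have -> : (fun w => [ffun ij : 'I_n * J =>
      random_sum (N (t ij.1)) (X ij.2) w]) @^-1` B =
    grid T' (fun t j => random_sum (N t) (X j)) @^-1` (at_times @^-1` B).
  by apply/seteqP; split=> w /=;
    rewrite (gridE _ (fun t j => random_sum (N t) (X j))).
apply: countable_law_eq => v; rewrite !pointE.
- exact: (measurable_path (fun k j => N_ j (s k))).
- exact: (measurable_path (fun k j => random_sum (N (s k)) (X j))).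
- exact: colored_path_le.
Qed.

End thinning.

(** * Two sums of three Poisson processes *)

Theorem theorem1 (R : realType) (lam0 lam1 lam2 lam : R)
  (lam0_gt0 : 0 < lam0) (lam1_gt0 : 0 < lam1) (lam2_gt0 : 0 < lam2)
  (lamE : lam = lam0 + lam1 + lam2)
  (d : measure_display) (T : measurableType d) (P : probability T R)
  (N0 N1 N2 : R -> {RV P >-> nat})
  (N0_poisson : poisson_process P lam0 N0)
  (N1_poisson : poisson_process P lam1 N1)
  (N2_poisson : poisson_process P lam2 N2)
  (N012_indep : mutual_independence P [set: 'I_3]
     (tnth [tuple sigma_family [set t : R | 0 <= t] N0;
                  sigma_family [set t : R | 0 <= t] N1;
                  sigma_family [set t : R | 0 <= t] N2]))
  (d' : measure_display) (T' : measurableType d') (Q : probability T' R)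
  (N : R -> {RV Q >-> nat})
  (N_poisson : poisson_process Q lam N)
  (I1 I2 I0 : nat -> {RV Q >-> nat})
  (I_iid : iid_from1 Q (fun i => pairRV (pairRV (I1 i) (I2 i)) (I0 i)))
  (NI_indep : mutual_independence Q [set: 'I_2]
     (tnth [tuple sigma_family [set t : R | 0 <= t] N;
                  sigma_family [set i | (1 <= i)%N]
                    (fun i => pairRV (pairRV (I1 i) (I2 i)) (I0 i))]))
  (I_law1 : forall i, (1 <= i)%N ->
     Q [set w | (I1 i w, I2 i w, I0 i w) = (1, 0, 0)%N] = (lam1 / lam)%:E)
  (I_law2 : forall i, (1 <= i)%N ->
     Q [set w | (I1 i w, I2 i w, I0 i w) = (0, 1, 0)%N] = (lam2 / lam)%:E)
  (I_law0 : forall i, (1 <= i)%N ->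
     Q [set w | (I1 i w, I2 i w, I0 i w) = (0, 0, 1)%N] = (lam0 / lam)%:E)
  (I_start : forall w, [/\ I1 0%N w = 0%N, I2 0%N w = 0%N & I0 0%N w = 0%N]) :
  let M1 t := addRV (N1 t) (N0 t) in
  let M2 t := addRV (N2 t) (N0 t) in
  let A1 t := random_sum (N t) (fun i => addRV (I1 i) (I0 i)) in
  let A2 t := random_sum (N t) (fun i => addRV (I2 i) (I0 i)) in
  same_fdd P Q
    (fun t => pairRV (M1 t) (M2 t)) (fun t => pairRV (A1 t) (A2 t)).
Proof.
move=> M1 M2 A1 A2 n t t_ge0 B mB; subst lam.
(* Index j of the colours is the index of the processes N0, N1, N2, and C j is the
   value (I1, I2, I0) of a mark of colour j. *)
pose lam := tnth [tuple lam0; lam1; lam2].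
pose N_ := tnth [tuple N0; N1; N2].
pose X (j : 'I_3) i := tnth [tuple I0 i; I1 i; I2 i] j.
pose V i := pairRV (pairRV (I1 i) (I2 i)) (I0 i).
pose C := tnth [tuple [set (0, 0, 1)%N]; [set (1, 0, 0)%N]; [set (0, 1, 0)%N]].
have lamE : \sum_j lam j = lam0 + lam1 + lam2.
  by rewrite !big_ord_recl big_ord0 addr0 addrA.
have lam_gt0 j : 0 < lam j by case: j => -[|[|[|//]]].
have L_gt0 : 0 < \sum_j lam j by rewrite lamE !addr_gt0.
have N_poisson' j : poisson_process P (lam j) (N_ j).
  by case: j => -[|[|[|//]]].
have N_indep : mutual_independence P [set: 'I_3]
    (fun j => sigma_family [set t : R | 0 <= t] (N_ j)).
  rewrite [X in mutual_independence _ _ X](_ : _ = tnth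
    [tuple sigma_family [set t : R | 0 <= t] N0;
           sigma_family [set t : R | 0 <= t] N1;
           sigma_family [set t : R | 0 <= t] N2])//.
  by apply/funext; case=> -[|[|[|//]]].
rewrite -lamE in N_poisson I_law0 I_law1 I_law2.
have m3 (a b c : nat) : measurable [set (a, b, c)].
  rewrite (_ : [set _] = ([set a] `*` [set b]) `*` [set c]).
    by do 2![apply: measurableX => //].
  by apply/seteqP; split=> [_ -> //|[[x y] z] [[/= -> ->] ->]].
have mC j : measurable (C j) by case: j => -[|[|[|//]]] ij; exact: m3.
have VC i j : (1 <= i)%N -> Q (V i @^-1` C j) = (lam j / \sum_j lam j)%:E.
  by move=> i1; case: j => -[|[|[|//]]] ij;
    [rewrite -(I_law0 i)|rewrite -(I_law1 i)|rewrite -(I_law2 i)].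
have X0 j w : X j 0%N w = 0%N.
  by have [I10 I20 I00] := I_start w; case: j => -[|[|[|//]]].
have XC i j l w : (0 < i)%N -> C j (V i w) -> X l i w = (l == j).
  by move=> _; case: j => -[|[|[|//]]] ?; case: l => -[|[|[|//]]] ? [].
have := colored_fdd lam_gt0 L_gt0 N_poisson' N_indep N_poisson I_iid.1
  (fun E F => mutual_independence_pair NI_indep) mC VC X0 XC.
pose o1 : 'I_3 := Ordinal (isT : 1 < 3)%N.
pose o2 : 'I_3 := Ordinal (isT : 2 < 3)%N.
(* The common function that takes the three counts to the two sums. *)
pose merge (v : {ffun 'I_n * 'I_3 -> nat}) : n.-tuple (nat * nat) :=
  [tuple ((v (i, o1) + v (i, ord0))%N, (v (i, o2) + v (i, ord0))%N) | i < n].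
move=> /(_ n t (merge @^-1` B) t_ge0) fdd.
rewrite /distribution /pushforward; etransitivity; [|etransitivity; [exact: fdd|]].
  congr (P _); apply/funext => w; congr (B _).
  by apply: eq_from_tnth => i; rewrite !tnth_mktuple !ffunE.
congr (Q _); apply/funext => w; congr (B _).
apply: eq_from_tnth => i; rewrite !tnth_mktuple !ffunE.
by congr pair; rewrite /= /random_sum big_split.
Qed.
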